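(* Let $G_0$ be a bipartite PMH-graph admitting $t$ (distinct) vertices $u_1,\dots,u_t$ of degree $3$, for some $t\in\{1,\dots,|V(G_0)|\}$, and let $\mathcal{I}\subseteq\{i : \deg(u_i)=3\}$ (that is, $\mathcal{I}\subseteq\{1,\dots,t\}$). For each $i\in\mathcal{I}$, let $G_i$ be a bipartite graph admitting a 3-malleable vertex $v_i$. Then the bipartite graph obtained by applying a star product on $u_i$ and $v_i$, for each $i\in\mathcal{I}$, is PMH.
   Context: Graphs are finite and connected, may have multiple (parallel) edges, and have no loops; the degree of a vertex is the number of edges incident to it. A perfect matching is the edge set of a $1$-regular spanning subgraph, and a Hamiltonian cycle is a connected $2$-regular spanning subgraph. A Hamiltonian cycle $H$ extends a perfect matching $M$ if $M\subseteq E(H)$. A graph admitting a perfect matching is PMH if each of its perfect matchings can be extended to a Hamiltonian cycle. For a vertex $v$, $\partial v$ denotes the set of edges incident to $v$. If $G$ admits a perfect matching and $v$ is a vertex of degree $t\ge 2$, then $v$ is $t$-malleable if for every perfect matching $M$ of $G$ there exist Hamiltonian cycles $H_1,\dots,H_{t-1}$ of $G$, all extending $M$, such that $\partial v - M\subset \bigcup_{i=1}^{t-1}E(H_i)$. Star product: let $u\in V(G)$, $v\in V(G')$ be vertices of degree 3 in vertex-disjoint graphs, with incident edges $ua_1,ua_2,ua_3$ and $vb_1,vb_2,vb_3$ respectively. A star product on $u$ and $v$ is the graph $(G-u)\cup(G'-v)\cup\{a_1b_1,a_2b_2,a_3b_3\}$ (for any choice of the ordering of the neighbours). It is assumed that neither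 $G$ nor $G'$ is the cubic graph on two vertices (three parallel edges). Applying a star product on $u_i$ and $v_i$ for each $i\in\mathcal{I}$ means applying these star products successively: starting from $G_0$, for each $i\in\mathcal{I}$ in turn, apply a star product on the vertex corresponding to $u_i$ in the current graph and the vertex $v_i$ of $G_i$ (each with any choice of ordering of the neighbours). *)

(* Defs.v *)
(* MathComp *)
From HB Require Import structures.
From mathcomp Require Import all_boot.

Set Implicit Arguments.
Unset Strict Implicit.
Unset Printing Implicit Defensive.

(* Finite loopless multigraphs; connectedness is the separate predicate
   [connected].  Parallel edges are distinct elements of [edge]. *)
Record mgraph : Type := MGraph {
  vert : finType;
  edge : finType;
  ends : edge -> {set vert};
  card_ends : forall e, #|ends e| = 2
}.

Section Basics.
Variable G : mgraph.
Implicit Types (v : vert G) (F M H : {set edge G}).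

Definition incident v : {set edge G} := [set e | v \in ends e].

Definition degree v : nat := #|incident v|.

Definition adj F : rel (vert G) :=
  [rel x y | [exists e in F, ends e == [set x; y]]].

(* The spanning subgraph with edge set [F] is connected. *)
Definition connected_by F : Prop := forall x y, connect (adj F) x y.

Definition connected : Prop := connected_by setT.

Definition bipartite : Prop :=
  exists A : {set vert G}, forall e, #|ends e :&: A| = 1.

Definition regular_by (k : nat) F : Prop :=
  forall v, #|F :&: incident v| = k.

Definition perfect_matching M : Prop := regular_by 1 M.

Definition hamiltonian_cycle H : Prop := regular_by 2 H /\ connected_by H.

Definition PMH : Prop :=
  (exists M, perfect_matching M) /\
  (forall M, perfect_matching M ->
     exists H, hamiltonian_cycle H /\ M \subset H).

Definition malleable (t : nat) v : Prop :=
  [/\ 2 <= t, degree v = t, exists M, perfect_matching M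
    & forall M, perfect_matching M ->
        exists H : 'I_t.-1 -> {set edge G},
          (forall i, hamiltonian_cycle (H i) /\ M \subset H i) /\
          incident v :\: M \subset \bigcup_i H i].

(* The cubic graph on two vertices, i.e. three parallel edges. *)
Definition is_theta : Prop := #|vert G| = 2 /\ regular_by 3 setT.

(* An ordering of the edges at [v]; one exists iff [v] has degree 3.  The
   edges, rather than the neighbours, are ordered, as the latter may coincide. *)
Record ordering3 (v : vert G) : Type := Ordering3 {
  order_edge :> 'I_3 -> edge G;
  order_inj : injective order_edge;
  order_im : [set order_edge j | j : 'I_3] = incident v
}.

Lemma order_ends v (a : ordering3 v) j : v \in ends (a j).
Proof.
have: a j \in incident v by rewrite -(order_im a) imset_f.
by rewrite inE.
Qed.

End Basics.

Section StarProduct.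
Variables (G G' : mgraph) (u : vert G) (v : vert G').
Variables (a : ordering3 u) (b : ordering3 v).

Definition star_vert : finType := ({x | x != u} + {y | y != v})%type.

Definition star_edge : finType :=
  ({e : edge G | u \notin ends e} + {e : edge G' | v \notin ends e} + 'I_3)%type.

(* The ends of the [j]-th new edge are the end of [a j] other than [u] and the
   end of [b j] other than [v]. *)
Definition star_ends (f : star_edge) : {set star_vert} :=
  match f with
  | inl (inl e) => [set inl x | x in [set x | val x \in ends (val e)]]
  | inl (inr e) => [set inr y | y in [set y | val y \in ends (val e)]]
  | inr j => [set inl x | x in [set x | val x \in ends (a j)]] :|:
             [set inr y | y in [set y | val y \in ends (b j)]]
  end.

Lemma card_val_ends (K : mgraph) (w : vert K) (e : edge K) :
  #|[set x : {x | x != w} | val x \in ends e]| = 2 - (w \in ends e).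
Proof.
rewrite -(card_imset _ val_inj).
have -> : [set val x | x in [set x : {x | x != w} | val x \in ends e]]
          = ends e :\ w.
  apply/setP => x; rewrite !inE; apply/imsetP/andP.
    by case=> y; rewrite inE => ye ->; split=> //; exact: (valP y).
  by case=> xw xe; exists (Sub x xw); rewrite ?inE SubK.
by have := cardsD1 w (ends e); rewrite card_ends => ->; rewrite addKn.
Qed.

Lemma card_star_ends f : #|star_ends f| = 2.
Proof.
have il : injective (@inl {x | x != u} {y | y != v}) by move=> ? ? [].
have ir : injective (@inr {x | x != u} {y | y != v}) by move=> ? ? [].
case: f => [[e|e]|j] /=.
- by rewrite (card_imset _ il) card_val_ends (negbTE (valP e)).
- by rewrite (card_imset _ ir) card_val_ends (negbTE (valP e)).
rewrite cardsU (card_imset _ il) (card_imset _ ir) !card_val_ends !order_ends.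
rewrite (_ : _ :&: _ = set0) ?cards0 //; apply/setP => w; rewrite !inE.
by apply/negP => /andP[/imsetP[x _ ->] /imsetP[]].
Qed.

Definition star_product : mgraph := MGraph card_star_ends.

(* The vertex of the star product corresponding to [x], if [x] is not [u]. *)
Definition star_left (x : vert G) : option (vert star_product) :=
  omap inl (insub x).

End StarProduct.

(* [star_products G v u s p], with [p : vert G0 -> option (vert K)]: the graph
   [K] is obtained from [G0] by applying star products on [u i] and [v i], for
   the successive indices [i] of [s], and [p] maps each vertex of [G0] to the
   corresponding vertex of [K], if it has not been removed. *)
Inductive star_products (G0 : mgraph) (t : nat) (u : 'I_t -> vert G0)
    (G : 'I_t -> mgraph) (v : forall i, vert (G i)) :
    seq 'I_t -> forall K : mgraph, (vert G0 -> option (vert K)) -> Prop :=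
| StarProducts0 : @star_products G0 t u G v [::] G0 Some
| StarProductsS s K (p : vert G0 -> option (vert K)) i (x : vert K)
    (a : ordering3 x) (b : ordering3 (v i)) :
    star_products u v s p ->
    p (u i) = Some x ->
    ~ is_theta K -> ~ is_theta (G i) ->
    star_products u v (rcons s i)
      (fun y => obind (star_left a b) (p y)).

(* Main.v *)
Require Import Defs.
From mathcomp Require Import all_boot.

Set Implicit Arguments.
Unset Strict Implicit.
Unset Printing Implicit Defensive.

(** A perfect matching [M] of a star product of [G] and [G'] meets the three
    new edges exactly once, because the two sides of the bipartite graph [G] are
    balanced; so [M] induces perfect matchings of [G] and of [G'].  A Hamiltonian
    cycle [H] of [G] extending the first one uses one further edge [a k] at [u],
    and malleability of [v] provides a Hamiltonian cycle [H'] of [G'] extending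
    the second one and using [b k].  Then [H] and [H'] use corresponding edges
    at [u] and [v], and glue to a Hamiltonian cycle of the star product: deleting
    a vertex does not disconnect a cycle, since every edge cut of a 2-regular
    graph is even. *)

Lemma card_val_setD1 (T : finType) (w : T) (B : {set T}) :
  #|[set x : {x | x != w} | val x \in B]| = #|B :\ w|.
Proof.
rewrite -(card_imset _ val_inj); congr #|pred_of_set _|.
apply/setP => x; rewrite !inE; apply/imsetP/andP.
  by case=> y; rewrite inE => yB ->; split=> //; exact: (valP y).
by case=> xw xB; exists (Sub x xw); rewrite ?inE SubK.
Qed.

(** * Cuts, degree sums and matchings in a single graph *)

Section Graph.
Variable G : mgraph.
Implicit Types (u v : vert G) (F M H : {set edge G}) (S T A : {set vert G}).

(** Connectivity is used through vertex sets closed under the edges of [F] rather than through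
    paths: such sets are easy to move between a star product and its factors. *)
Lemma connected_by_cutP F :
  connected_by F <->
  forall S, (forall e x y, e \in F -> x \in ends e -> y \in ends e ->
               x \in S -> y \in S) ->
  forall x y, x \in S -> y \in S.
Proof.
split=> [conF S cutS x y Sx | cutF x y].
  have clS : closed (adj F) (mem S).
    move=> z w /existsP[e /andP[eF /eqP ze]].
    by apply/idP/idP; apply: cutS eF _ _; rewrite ze !inE eqxx ?orbT.
  by have <- := closed_connect clS (conF x y).
have := cutF [set z | connect (adj F) x z] _ x y; rewrite !inE connect0; apply=> //.
move=> e z w eF ze we; rewrite !inE => xz.
have [<-//|zw] := eqVneq z w.
apply: connect_trans xz (connect1 _); apply/existsP; exists e; rewrite eF /=.
by rewrite eq_sym eqEcard card_ends cards2 zw subUset !sub1set ze we.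
Qed.

Lemma sum_degree F S :
  \sum_(x in S) #|F :&: incident x| = \sum_(e in F) #|ends e :&: S|.
Proof.
under eq_bigr do rewrite -sum1_card (eq_bigl _ _ (fun _ => in_setI _ _ _)) big_mkcondr.
rewrite exchange_big /=; apply: eq_bigr => e _.
rewrite setIC -sum1_card (eq_bigl _ _ (fun _ => in_setI _ _ _)) big_mkcondr.
by apply: eq_bigr => x _; rewrite inE.
Qed.

Lemma bipartite_side u : bipartite G ->
  exists2 A : {set vert G}, u \in A & forall e, #|ends e :&: A| = 1.
Proof.
case=> A Ae; case: (boolP (u \in A)) => uA; first by exists A.
exists (~: A) => [|e]; first by rewrite inE.
by have := cardsID A (ends e); rewrite card_ends Ae -setDE => -[].
Qed.

(** Both sums count the edges of [F], each having one end in [A] and one outside. *)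
Lemma bipartite_sum_degree A F : (forall e, #|ends e :&: A| = 1) ->
  \sum_(x in A) #|F :&: incident x| = \sum_(x in ~: A) #|F :&: incident x|.
Proof.
move=> Ae; rewrite !sum_degree; apply: eq_bigr => e _; rewrite Ae.
by have := cardsID A (ends e); rewrite card_ends Ae -setDE => -[].
Qed.

(** The matching [M] forces the two colour classes to have equal size. The degree sums of [F] over
    them agree, and every degree other than that at [u] is 1, so the remaining one is 1 too. *)
Lemma bipartite_perfect_matching u M F : bipartite G -> perfect_matching M ->
  (forall x, x != u -> #|F :&: incident x| = 1) -> perfect_matching F.
Proof.
move=> /(bipartite_side u)[A uA Ae] pmM F1 x.
have [->|/F1//] := eqVneq x u.
have := bipartite_sum_degree F Ae; have := bipartite_sum_degree M Ae.
rewrite !(bigD1 (P := mem A) u) //= pmM.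
rewrite !(eq_bigr (fun _ => 1) (fun y _ => pmM y)) => eqM.
rewrite [in RHS](eq_bigr (fun _ => 1)) => [|y yA]; last first.
  by apply: F1; apply: contraTneq yA => ->; rewrite inE uA.
rewrite (eq_bigr (fun _ => 1)) => [|y /andP[_ yu]]; last exact: F1.
by rewrite -eqM => /eqP; rewrite eqn_add2r => /eqP.
Qed.

Lemma hamiltonian_setD_perfect_matching H M :
  hamiltonian_cycle H -> perfect_matching M -> M \subset H ->
  perfect_matching (H :\: M).
Proof.
move=> [H2 _] M1 sMH x.
have := cardsID M (H :&: incident x); rewrite H2 setIAC (setIidPr sMH) M1.
by rewrite setIDAC => -[].
Qed.

(** If a matching avoids [e], some Hamiltonian cycle extending it contains [e]; removing the
    matching from that cycle leaves a perfect matching through [e]. *)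
Lemma malleable_perfect_matching t v (e : edge G) :
  malleable t v -> e \in incident v ->
  exists2 M : {set edge G}, perfect_matching M & e \in M.
Proof.
case=> _ _ [M pmM] malM ev; have [eM|eM] := boolP (e \in M); first by exists M.
have [H [hamH /subsetP/(_ e)]] := malM M pmM.
rewrite in_setD eM ev => /(_ isT)/bigcupP[i _ eH].
have [hamHi sMH] := hamH i.
exists (H i :\: M); last by rewrite inE eM.
exact: hamiltonian_setD_perfect_matching.
Qed.

(* Deleting [u] from a Hamiltonian cycle leaves a connected graph. *)
Lemma hamiltonian_cycle_cut H u T : hamiltonian_cycle H -> u \notin T ->
  (forall e x y, e \in H -> u \notin ends e -> x \in ends e -> y \in ends e ->
     x \in T -> y \in T) ->
  forall x y, y != u -> x \in T -> y \in T.
Proof.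
move=> [H2 /connected_by_cutP conH] uT cutT x y yu xT.
have le1 e : u \in ends e -> #|ends e :&: T| <= 1.
  move=> ue; have := cardsD1 u (ends e); rewrite card_ends ue => -[->].
  apply/subset_leq_card/subsetP => z; rewrite !inE => /andP[-> zT]; rewrite andbT.
  by apply: contraNneq uT => <-.
(* The degrees over [T] sum to twice [#|T|], and an edge of [H] avoiding [u] has no end or both ends
   in [T]; hence the edges at [u] have an even number of ends in [T]. *)
have even_u : ~~ odd (\sum_(e in H :&: incident u) #|ends e :&: T|).
  have := sum_degree H T; under eq_bigr do rewrite H2.
  rewrite sum_nat_const (bigID (mem (incident u)))/=.
  move/(congr1 odd); rewrite oddM andbF oddD.
  rewrite [X in _ (+) X](_ : _ = false) ?addbF.
    by rewrite (eq_bigl _ _ (fun _ => in_setI _ _ _)) => <-.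
  elim/big_ind: _ => [//|m n|e]; first by rewrite oddD => -> ->.
  rewrite inE => /andP[eH ue].
  have [->|[z]] := set_0Vmem (ends e :&: T); first by rewrite cards0.
  rewrite inE => /andP[ze zT]; rewrite (setIidPl _) ?card_ends //.
  by apply/subsetP => w we; apply: cutT eH ue ze we zT.
have /eqP/cards2P[e1 [e2 [e12 Hu]]] := H2 u.
have inHu e : e \in H -> u \in ends e -> (e == e1) || (e == e2).
  by move=> eH ue; rewrite -in_set2 -Hu !inE eH.
have /setIP[_] : e1 \in H :&: incident u by rewrite Hu !inE eqxx.
have /setIP[_] : e2 \in H :&: incident u by rewrite Hu !inE eqxx orbT.
rewrite !inE => u2 u1.
have eq12 : #|ends e1 :&: T| = #|ends e2 :&: T|.
  move: even_u (le1 _ u1) (le1 _ u2); rewrite Hu big_setU1 ?inE //= big_set1.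
  by case: #|_| => [|[]] //; case: #|_| => [|[]].
have eqHu e : e \in H -> u \in ends e -> #|ends e :&: T| = #|ends e1 :&: T|.
  by move=> eH ue; case/orP: (inHu e eH ue) => /eqP->.
(* If no edge of [H] at [u] reaches [T], then [T] is closed under all of [H] and would contain
   [u]. *)
have [T0|Tn0] := eqVneq #|ends e1 :&: T| 0.
  case/negP: uT; apply: conH xT => e z w eH ze we zT.
  have [ue|ue] := boolP (u \in ends e); last exact: cutT eH ue ze we zT.
  have /eqP := eqHu e eH ue; rewrite T0 cards_eq0 => /eqP/setP/(_ z).
  by rewrite !inE ze zT.
(* Otherwise both edges at [u] lead into [T], so [u |: T] is closed under [H] and is the whole
   vertex set. *)
suff: y \in u |: T by rewrite !inE (negPf yu).
apply: (conH (u |: T) _ x); last by rewrite inE xT orbT.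
move=> e z w eH ze we; rewrite !inE => zT.
have [//|wu] := eqVneq w u.
have [ue|ue] := boolP (u \in ends e); last first.
  case/orP: zT => [/eqP zu|]; first by rewrite -zu ze in ue.
  exact: cutT eH ue ze we.
have /card_gt0P[q] : 0 < #|ends e :&: T| by rewrite eqHu // lt0n.
rewrite inE => /andP[qe qT].
(* If [w] were outside [T], then [u], [w] and [q] would be three distinct ends of [e]. *)
apply: contra_eqT (card_ends e) => /= wT; rewrite neq_ltn; apply/orP; right.
have wq : w != q by apply: contraNneq wT => ->.
have uwq : u \notin [set w; q].
  by rewrite !inE negb_or eq_sym wu; apply: contraNneq uT => ->.
have <- : #|u |: [set w; q]| = 3 by rewrite cardsU1 uwq cards2 wq.
by apply/subset_leq_card; rewrite !subUset !sub1set ue we qe.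
Qed.

Lemma PMH_connected : PMH G -> connected G.
Proof.
case=> -[M pmM] /(_ M pmM)[H [[_ /connected_by_cutP conH] _]].
by apply/connected_by_cutP => S cutS; apply: conH => e x y _; apply: cutS.
Qed.

End Graph.

(** * Orderings of the edges at a vertex of degree 3 *)

Lemma orderP (G : mgraph) (u : vert G) (a : ordering3 u) (e : edge G) :
  u \in ends e -> exists j, a j = e.
Proof.
move=> ue; have : e \in incident u by rewrite inE.
by rewrite -(order_im a) => /imsetP[j _ ->]; exists j.
Qed.

Lemma card_order (G : mgraph) (u : vert G) (a : ordering3 u) (F : {set edge G}) :
  #|a @^-1: F| = #|F :&: incident u|.
Proof.
rewrite -(card_imset _ (@order_inj _ _ a)); congr #|pred_of_set _|.
apply/setP => e; rewrite -(order_im a) inE; apply/imsetP/andP.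
  by case=> j; rewrite inE => jF ->; rewrite imset_f.
by case=> eF /imsetP[j _ ej]; exists j => //; rewrite inE -ej.
Qed.

(* One side of a star product [K], seen as a contraction of the opposite side
   to the vertex [u] of [G]: [f] and [g] send the edges of [G], and its vertices
   other than [u], to those of [K]. *)
Section Side.
Variables (G K : mgraph) (u : vert G).
Variables (f : edge G -> edge K) (g : {x | x != u} -> vert K).
Hypothesis f_inj : injective f.
Hypothesis incident_g : forall x, incident (g x) = f @: incident (val x).

Lemma card_incident_side (F : {set edge K}) x :
  #|F :&: incident (g x)| = #|(f @^-1: F) :&: incident (val x)|.
Proof.
rewrite incident_g -(card_imset _ f_inj); congr #|pred_of_set _|.
apply/setP => e; rewrite inE; apply/andP/imsetP.
  by case=> eF /imsetP[d dx ed]; exists d => //; rewrite in_setI dx inE -ed eF.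
by case=> d; rewrite !inE => /andP[dF dx] ->; rewrite dF imset_f ?inE.
Qed.

(** Vertices other than [u] keep their degree under [f]; the degree at the contracted vertex [u]
    then follows from the balance of the bipartite graph [G]. *)
Lemma side_perfect_matching (M : {set edge K}) : bipartite G ->
  (exists N : {set edge G}, perfect_matching N) ->
  perfect_matching M -> perfect_matching (f @^-1: M).
Proof.
move=> bipG [N pmN] pmM; apply: (bipartite_perfect_matching bipG pmN) => x xu.
by have := pmM (g (Sub x xu)); rewrite card_incident_side SubK.
Qed.

(** The trace of [S] on this side, read as a vertex set of [G] avoiding [u], is closed under the
    cycle edges that avoid [u]; so [S] contains all of this side or none of it. *)
Lemma side_hamiltonian_cut (H : {set edge K}) (S : {set vert K}) :
  hamiltonian_cycle (f @^-1: H) ->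
  (forall e x y, e \in H -> x \in ends e -> y \in ends e ->
     x \in S -> y \in S) ->
  forall x y, g x \in S -> g y \in S.
Proof.
move=> hamH cutS x y xS.
have TE z : (val z \in [set val w | w in g @^-1: S]) = (g z \in S).
  by rewrite mem_imset ?inE //; apply: val_inj.
rewrite -TE; apply: (hamiltonian_cycle_cut hamH) (valP y) (_ : val x \in _).
- by apply/imsetP => -[z _ uz]; have := valP z; rewrite -uz /= eqxx.
- move=> e z w; rewrite inE => eH ue ze we.
  have zu : z != u by apply: contraNneq ue => <-.
  have wu : w != u by apply: contraNneq ue => <-.
  rewrite -[z](SubK {x | x != u} zu) -[w](SubK {x | x != u} wu) !TE.
  have ends_g q (qu : q != u) : q \in ends e -> g (Sub q qu) \in ends (f e).
    move=> qe; have : f e \in incident (g (Sub q qu)).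
      by rewrite incident_g SubK imset_f // inE.
    by rewrite inE.
  by apply: cutS eH _ _; apply: ends_g.
- by rewrite TE.
Qed.

End Side.

(** * The two factors as sides of a star product *)

Section StarProduct.
Variables (G G' : mgraph) (u : vert G) (v : vert G').
Variables (a : ordering3 u) (b : ordering3 v).
Let K := star_product a b.

(** An edge at [u] goes to the new edge with the same index. The default [ord0] is never reached,
    since [a] enumerates all edges at [u]; likewise for [starr]. *)
Definition starl (e : edge G) : edge K :=
  if insub e is Some e' then inl (inl e')
  else inr (odflt ord0 [pick j | a j == e]).

Definition starr (e : edge G') : edge K :=
  if insub e is Some e' then inl (inr e')
  else inr (odflt ord0 [pick j | b j == e]).

Lemma starl_val (e : {e | u \notin ends e}) : starl (val e) = inl (inl e).
Proof. by rewrite /starl valK. Qed.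

Lemma starr_val (e : {e | v \notin ends e}) : starr (val e) = inl (inr e).
Proof. by rewrite /starr valK. Qed.

Lemma starl_order j : starl (a j) = inr j.
Proof.
rewrite /starl insubN ?negbK ?order_ends //; case: pickP => [k /eqP|/(_ j)] /=.
  by move/order_inj->.
by rewrite eqxx.
Qed.

Lemma starr_order j : starr (b j) = inr j.
Proof.
rewrite /starr insubN ?negbK ?order_ends //; case: pickP => [k /eqP|/(_ j)] /=.
  by move/order_inj->.
by rewrite eqxx.
Qed.

Lemma starl_inj : injective starl.
Proof.
have cases e : (exists d : {e | u \notin ends e}, e = val d) \/
               (exists j, e = a j).
  have [ue|ue] := boolP (u \in ends e); last by left; exists (Sub e ue).
  by right; have [j <-] := orderP a ue; exists j.
move=> e1 e2; case: (cases e1) (cases e2) => [[d1 ->]|[j1 ->]] [[d2 ->]|[j2 ->]];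
by rewrite ?starl_val ?starl_order => // -[->].
Qed.

Lemma starr_inj : injective starr.
Proof.
have cases e : (exists d : {e | v \notin ends e}, e = val d) \/
               (exists j, e = b j).
  have [ve|ve] := boolP (v \in ends e); last by left; exists (Sub e ve).
  by right; have [j <-] := orderP b ve; exists j.
move=> e1 e2; case: (cases e1) (cases e2) => [[d1 ->]|[j1 ->]] [[d2 ->]|[j2 ->]];
by rewrite ?starr_val ?starr_order => // -[->].
Qed.

Let gl (x : {x | x != u}) : vert K := inl x.
Let gr (y : {y | y != v}) : vert K := inr y.

Let gl_inj : injective gl. Proof. by move=> ? ? []. Qed.
Let gr_inj : injective gr. Proof. by move=> ? ? []. Qed.

(** Supplies the hypothesis [incident_g] that makes the left factor a side of [K]. *)
Lemma incident_starl x : incident (gl x) = starl @: incident (val x).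
Proof.
apply/setP => -[[e|e]|j]; rewrite inE /=.
- by rewrite -starl_val (mem_imset _ _ starl_inj) (mem_imset _ _ gl_inj) !inE.
- apply/imsetP/imsetP => [[]//|[d _]].
  by rewrite /starl; case: insubP.
rewrite -starl_order (mem_imset _ _ starl_inj) inE (mem_imset _ _ gl_inj) !inE.
by case: imsetP => [[]//|_]; rewrite orbF.
Qed.

Lemma incident_starr y : incident (gr y) = starr @: incident (val y).
Proof.
apply/setP => -[[e|e]|j]; rewrite inE /=.
- apply/imsetP/imsetP => [[]//|[d _]].
  by rewrite /starr; case: insubP.
- by rewrite -starr_val (mem_imset _ _ starr_inj) (mem_imset _ _ gr_inj) !inE.
rewrite -starr_order (mem_imset _ _ starr_inj) inE (mem_imset _ _ gr_inj) !inE.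
by case: imsetP => [[]//|_].
Qed.

(** A new edge enters as soon as one factor uses it, so the union restricts back to [F] and [F']
    only when both use the same indices. *)
Definition glue (F : {set edge G}) (F' : {set edge G'}) : {set edge K} :=
  (starl @: F) :|: (starr @: F').

(** * Gluing edge sets that agree on the new edges *)

Section Glue.
Variables (F : {set edge G}) (F' : {set edge G'}).
Hypothesis eqFF' : a @^-1: F = b @^-1: F'.

Let order_glue j : (a j \in F) = (b j \in F').
Proof. by move/setP/(_ j): eqFF'; rewrite !inE. Qed.

Lemma glue_starl : starl @^-1: glue F F' = F.
Proof.
apply/setP => e; rewrite !inE (mem_imset _ _ starl_inj).
apply/orP/idP=> [[//|/imsetP[d dF']]|]; last by left.
have [ue|ue] := boolP (u \in ends e).
  have [j <-] := orderP a ue; rewrite starl_order -starr_order.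
  by move/starr_inj=> bd; rewrite order_glue bd.
rewrite -[e](SubK {e | u \notin ends e} ue) starl_val.
by rewrite /starr; case: insubP.
Qed.

Lemma glue_starr : starr @^-1: glue F F' = F'.
Proof.
apply/setP => e; rewrite !inE (mem_imset _ _ starr_inj).
apply/orP/idP=> [[/imsetP[d dF]|//]|]; last by right.
have [ve|ve] := boolP (v \in ends e).
  have [j <-] := orderP b ve; rewrite starr_order -starl_order.
  by move/starl_inj=> ad; rewrite -order_glue ad.
rewrite -[e](SubK {e | v \notin ends e} ve) starr_val.
by rewrite /starl; case: insubP.
Qed.

Lemma glue_regular k : regular_by k F -> regular_by k F' ->
  regular_by k (glue F F').
Proof.
move=> Fk F'k [x|y].
  by rewrite (card_incident_side starl_inj incident_starl) glue_starl.
by rewrite (card_incident_side starr_inj incident_starr) glue_starr.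
Qed.

Lemma glue_hamiltonian : hamiltonian_cycle F -> hamiltonian_cycle F' ->
  hamiltonian_cycle (glue F F').
Proof.
move=> hamF hamF'; have [[F2 _] [F'2 _]] := (hamF, hamF').
split; first exact: glue_regular.
apply/connected_by_cutP => S cutS.
have cutl x y : gl x \in S -> gl y \in S.
  apply: (side_hamiltonian_cut incident_starl) cutS x y.
  by rewrite glue_starl.
have cutr x y : gr x \in S -> gr y \in S.
  apply: (side_hamiltonian_cut incident_starr) cutS x y.
  by rewrite glue_starr.
(* Each side lies inside [S] or misses it; a new edge in the glued set, provided by the degree 2 of
   [F] at [u], carries membership across. *)
have /card_gt0P[j] : 0 < #|a @^-1: F| by rewrite card_order F2.
rewrite inE => jF.
have jH : (inr j : edge K) \in glue F F'.
  by rewrite inE -starl_order imset_f.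
have /card_gt0P[x] : 0 < #|[set x : {x | x != u} | val x \in ends (a j)]|.
  by rewrite card_val_ends order_ends.
have /card_gt0P[y] : 0 < #|[set y : {y | y != v} | val y \in ends (b j)]|.
  by rewrite card_val_ends order_ends.
move=> yj xj.
have xe : gl x \in @ends K (inr j).
  by rewrite /= inE (mem_imset _ _ gl_inj) xj.
have ye : gr y \in @ends K (inr j).
  by rewrite /= inE (mem_imset _ _ gr_inj) yj orbT.
move=> [z|z] [w|w]; [exact: cutl| | |exact: cutr].
  by move/(cutl z x)/(cutS _ _ _ jH xe ye)/cutr; apply.
by move/(cutr z y)/(cutS _ _ _ jH ye xe)/cutl; apply.
Qed.

End Glue.

(** * Bipartiteness and the PMH property of a star product *)

Lemma star_bipartite : bipartite G -> bipartite G' -> bipartite K.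
Proof.
move=> /(bipartite_side u)[A uA Ae] /(bipartite_side v)[B vB Be].
have B'e e : #|ends e :&: ~: B| = 1.
  by have := cardsID B (ends e); rewrite card_ends Be -setDE => -[].
(* With [u] in [A] and [v] in [B], a new edge joins a vertex outside [A] to one outside [B]; hence
   [A] on the left is combined with the complement of [B] on the right. *)
exists ((gl @: [set x | val x \in A]) :|: (gr @: [set y | val y \in ~: B])) => f.
pose P := [set x : {x | x != u} | gl x \in @ends K f].
pose Q := [set y : {y | y != v} | gr y \in @ends K f].
have grl x (C : {set {y | y != v}}) : (gl x \in gr @: C) = false.
  by apply/imsetP => -[].
have glr y (C : {set {x | x != u}}) : (gr y \in gl @: C) = false.
  by apply/imsetP => -[].
have -> : ends f :&: (gl @: [set x | val x \in A] :|:
                      gr @: [set y | val y \in ~: B])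
          = gl @: (P :&: [set x | val x \in A]) :|:
            gr @: (Q :&: [set y | val y \in ~: B]).
  apply/setP => -[x|y]; rewrite !in_setI !in_setU ?grl ?glr ?orbF /=;
  by rewrite ?(mem_imset _ _ gl_inj) ?(mem_imset _ _ gr_inj) in_setI [in RHS]inE.
rewrite cardsU (card_imset _ gl_inj) (card_imset _ gr_inj).
rewrite [X in _ - #|pred_of_set X|](_ : _ = set0) ?cards0 ?subn0; last first.
  by apply/setP => -[x|y]; rewrite in_setI ?grl ?glr ?andbF inE.
(* The unique end of [e] in [A] is lost exactly when it is [u], whereas on the right [v] is not in
   the class and nothing is lost. *)
have cardP (e : edge G) : (forall x, (gl x \in @ends K f) = (val x \in ends e)) ->
    #|P :&: [set x | val x \in A]| = (u \notin ends e).
  move=> fe; have := cardsD1 u (ends e :&: A); rewrite Ae inE uA andbT.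
  rewrite -card_val_setD1; set X := #|_|; set Y := #|_|; suff -> : X = Y.
    by case: (u \in ends e) => -[].
  by congr #|pred_of_set _|; apply/setP => x; rewrite !inE fe.
have cardQ (e : edge G') : (forall y, (gr y \in @ends K f) = (val y \in ends e)) ->
    #|Q :&: [set y | val y \in ~: B]| = 1.
  move=> fe; have := cardsD1 v (ends e :&: ~: B); rewrite B'e !inE vB andbF.
  rewrite -card_val_setD1 => ->.
  by congr #|pred_of_set _|; apply/setP => y; rewrite !inE fe.
case: f @P @Q {cardP cardQ} (cardP) (cardQ) => [[e|e]|j] P Q cardP cardQ.
- rewrite (cardP (val e)) ?(valP e) => [|x].
    rewrite (_ : Q = set0) ?set0I ?cards0 //.
    by apply/setP => y; rewrite inE /= glr inE.
  by rewrite /= (mem_imset _ _ gl_inj) inE.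
- rewrite (cardQ (val e)) => [|y]; last by rewrite /= (mem_imset _ _ gr_inj) inE.
  rewrite (_ : P = set0) ?set0I ?cards0 //.
  by apply/setP => x; rewrite inE /= grl inE.
rewrite (cardP (a j)) ?(cardQ (b j)) ?order_ends // => x;
by rewrite /= inE ?grl ?glr ?orbF ?(mem_imset _ _ gl_inj) ?(mem_imset _ _ gr_inj) inE.
Qed.

Lemma star_PMH : bipartite G -> bipartite G' -> PMH G -> malleable 3 v -> PMH K.
Proof.
move=> bipG bipG' [exM PMHG] malv; split.
  (* For the existence of a perfect matching, one of [G] using [a j] is glued to one of [G'] using
     [b j], which malleability provides. *)
  have [M pmM] := exM.
  have /eqP/cards1P[j Mj] : #|a @^-1: M| = 1 by rewrite card_order pmM.
  have jv : b j \in incident v by rewrite inE order_ends.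
  have [M' pmM' jM'] := malleable_perfect_matching malv jv.
  have /eqP/cards1P[k Mk] : #|b @^-1: M'| = 1 by rewrite card_order pmM'.
  exists (glue M M'); apply: glue_regular => //; rewrite Mj Mk.
  by congr [set _]; apply/eqP; rewrite -in_set1 -Mk inE.
move=> N pmN.
case: (malv) => _ _ exM' malM'.
have pmM := side_perfect_matching starl_inj incident_starl bipG exM pmN.
have pmM' := side_perfect_matching starr_inj incident_starr bipG' exM' pmN.
have [H [hamH sMH]] := PMHG _ pmM; have [H2 _] := hamH.
have NE : a @^-1: (starl @^-1: N) = b @^-1: (starr @^-1: N).
  by apply/setP => j; rewrite !inE starl_order starr_order.
have : a @^-1: (starl @^-1: N) \proper a @^-1: H.
  by rewrite properEcard preimsetS // !card_order pmM H2.
case/properP=> sNH [k kH kN].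
have [H' [hamH' sH']] := malM' _ pmM'.
have : b k \in \bigcup_i H' i.
  apply: (subsetP sH'); move: kN; rewrite NE !inE => kN.
  by rewrite kN order_ends.
case/bigcupP=> i _ kH'.
have [hamHi sMH'] := hamH' i; have [Hi2 _] := hamHi.
(* Both index sets have two elements and contain [k] and the single index used by [N]. *)
have HE : a @^-1: H = b @^-1: (H' i).
  transitivity (k |: a @^-1: (starl @^-1: N)); apply/eqP; [rewrite eq_sym|];
  rewrite eqEcard cardsU1 kN subUset sub1set !card_order pmM ?H2 ?Hi2.
    by rewrite kH sNH.
  by rewrite inE kH' NE preimsetS.
exists (glue H (H' i)); split; first exact: glue_hamiltonian.
apply/subsetP => -[[e|e]|j] eN.
- rewrite inE -starl_val imset_f //.
  by apply: (subsetP sMH); rewrite inE starl_val.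
- rewrite inE -starr_val orbC imset_f //.
  by apply: (subsetP sMH'); rewrite inE starr_val.
rewrite inE -starl_order imset_f //.
by apply: (subsetP sMH); rewrite inE starl_order.
Qed.

End StarProduct.

Theorem theorem3p6 (G0 : mgraph) (t : nat) (u : 'I_t -> vert G0)
    (I : {set 'I_t}) (G : 'I_t -> mgraph) (v : forall i : 'I_t, vert (G i))
    (s : seq 'I_t) (K : mgraph) (p : vert G0 -> option (vert K)) :
  connected G0 -> bipartite G0 -> PMH G0 ->
  1 <= t <= #|vert G0| ->
  injective u ->
  (forall i, degree (u i) = 3) ->
  (forall i, i \in I ->
     [/\ connected (G i), bipartite (G i) & malleable 3 (v i)]) ->
  perm_eq s (enum I) ->
  star_products u v s p ->
  [/\ connected K, bipartite K & PMH K].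
Proof.
move=> conG0 bipG0 PMHG0 _ _ _ malG /perm_mem sI.
(* Inclusion in [I], unlike being a permutation of it, passes to the prefixes of [s] met in the
   induction on the successive products. *)
have {sI}: {subset s <= I} by move=> i; rewrite sI mem_enum.
move=> sI prod; elim: prod sI => {s K p} [|s K p i x a b _ IH _ _ _] sI //.
have [_ bipK PMHK] : [/\ connected K, bipartite K & PMH K].
  by apply: IH => j js; apply: sI; rewrite mem_rcons inE js orbT.
have [_ bipG malv] : [/\ connected (G i), bipartite (G i) & malleable 3 (v i)].
  by apply: malG; apply: sI; rewrite mem_rcons inE eqxx.
have PMHab := star_PMH a b bipK bipG PMHK malv.
by split=> //; [apply: PMH_connected | apply: star_bipartite].
Qed.
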